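(* Let $G$ be a finite, simple, connected graph on $n$ vertices with diameter $2$ and let $D$ be the distance matrix of $G$. Let $v$ be the top eigenvector of $D$, normalized to have $L^2$ norm $1$. Then $$\frac{\langle v,\mathbbm{1}\rangle}{\sqrt{n}}\geq\frac{4}{3}\cdot\frac{1}{\sqrt{2}}.$$
   Context: The distance matrix of a connected graph with vertices $v_1,\dots,v_n$ has entries $D_{ij}=d(v_i,v_j)$ (shortest-path distance). The top eigenvector is the eigenvector with nonnegative entries corresponding to the largest (Perron–Frobenius) eigenvalue of $D$. $\mathbbm{1}$ is the all-ones vector and $\langle\cdot,\cdot\rangle$ the standard inner product on $\mathbb{R}^n$; the $L^2$ norm is the Euclidean norm. *)

(* Defs.v *)
From mathcomp Require Import all_boot all_order all_algebra reals.

Set Implicit Arguments.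
Unset Strict Implicit.
Unset Printing Implicit Defensive.

Import Order.TTheory GRing.Theory Num.Theory.

Local Open Scope ring_scope.

Section Graph.
Variables (T : finType) (e : rel T).

Definition simple_graph : Prop := symmetric e /\ irreflexive e.

Definition connected_graph : Prop := forall x y : T, connect e x y.

(* The tuple [p] lists the vertices following [x], so its size is the number
   of edges. *)
Definition has_path (k : nat) (x y : T) : bool :=
  [exists p : k.-tuple T, [&& path e x p, uniq (x :: p) & last x p == y]].

(* A path, having no repeated vertex, has fewer than [#|T|] edges; the default
   value [#|T|] is reached only when [y] is not connected to [x]. *)
Definition gdist (x y : T) : nat :=
  \big[minn/#|T|]_(k < #|T| | has_path k x y) k.

Definition diameter : nat := \max_(x : T) \max_(y : T) gdist x y.

End Graph.

Definition distance_matrix (R : realType) (n : nat) (e : rel 'I_n) : 'M[R]_n :=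
  \matrix_(i, j) (gdist e i j)%:R.

Definition inner (R : realType) (n : nat) (u v : 'cV[R]_n) : R :=
  \sum_(i < n) u i 0 * v i 0.

Definition norm2 (R : realType) (n : nat) (v : 'cV[R]_n) : R :=
  Num.sqrt (inner v v).

Definition ones (R : realType) (n : nat) : 'cV[R]_n := const_mx 1.

(* MathComp's [eigenvalue] is stated with row vectors; a square matrix and its
   transpose have the same eigenvalues. *)
Definition largest_eigenvalue (R : realType) (n : nat) (A : 'M[R]_n) (l : R) :
    Prop :=
  eigenvalue A l /\ (forall m : R, eigenvalue A m -> m <= l).

Definition top_eigenvector (R : realType) (n : nat) (A : 'M[R]_n)
    (v : 'cV[R]_n) : Prop :=
  exists l : R, [/\ largest_eigenvalue A l, A *m v = l *: v, v != 0
                  & forall i : 'I_n, 0 <= v i 0].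

(* Main.v *)
Require Import Defs.
From mathcomp Require Import all_boot all_order all_algebra reals.
From mathcomp Require Import ring lra.
Import Order.TTheory GRing.Theory Num.Theory.
Local Open Scope ring_scope.

(** The off-diagonal entries of the distance matrix [D] are 1 or 2, so the
    entries of the top eigenvector cannot vary by more than a factor 2.  Indeed,
    write [l] for the top eigenvalue and [S] for the sum of the entries of [v].
    The equation [l v_i = \sum_(j != i) D_ij v_j] gives
    [S - v_i <= l v_i <= 2 (S - v_i)], and hence [a <= v_i <= 2 a] with
    [a = S / (l + 1)] ([top_eigenvector_pinched]).

    A vector whose entries are this close to each other makes a small angle with
    the all-ones vector: this is the Polya-Szego reversal of the Cauchy-Schwarz
    inequality ([reverse_Cauchy_Schwarz_ones]).  For entries between [a] and
    [2 a] its constant is [4 * a * 2a / (a + 2a)^2 = 8/9], whose square root is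
    [4/3 * 1/sqrt 2]. *)

(** The product [(x_i - m) (M - x_i)] is nonnegative; summing over [i] bounds
    [\sum x_i^2 + n m M] by [(m + M) \sum x_i], and the inequality of arithmetic
    and geometric means bounds the same quantity from below. *)
Lemma reverse_Cauchy_Schwarz_ones (R : realFieldType) (I : finType)
    (x : I -> R) (m M : R) :
  0 <= m -> (forall i, m <= x i <= M) ->
  4 * (m * M) * (#|I|%:R * \sum_i x i ^+ 2) <= (m + M) ^+ 2 * (\sum_i x i) ^+ 2.
Proof.
move=> m_ge0 x_mM.
have [/card0_eq I0|/card_gt0P [i0 _]] := posnP #|I|.
  by rewrite !big_pred0 // expr0n /= !mulr0.
have mM : m <= M by have /andP[mx xM] := x_mM i0; exact: le_trans mx xM.
set S := \sum_i x i; set Q := \sum_i x i ^+ 2.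
have Q_ge0 : 0 <= Q by apply: sumr_ge0 => i _; exact: sqr_ge0.
have mM_ge0 : 0 <= #|I|%:R * (m * M).
  by rewrite !mulr_ge0 ?ler0n // (le_trans m_ge0).
have sum_ge0 : 0 <= (m + M) * S - Q - #|I|%:R * (m * M).
  suff -> : (m + M) * S - Q - #|I|%:R * (m * M)
            = \sum_i (x i - m) * (M - x i).
    apply: sumr_ge0 => i _; have /andP[mx xM] := x_mM i.
    by rewrite mulr_ge0 ?subr_ge0.
  rewrite (eq_bigr (fun i => (m + M) * x i - x i ^+ 2 - m * M)); last first.
    by move=> i _; ring.
  by rewrite !sumrB -mulr_sumr sumr_const -[in RHS]mulr_natl.
rewrite -exprMn; apply: (@le_trans _ _ ((Q + #|I|%:R * (m * M)) ^+ 2)).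
  by have := sqr_ge0 (Q - #|I|%:R * (m * M)); lra.
by rewrite ler_sqr ?nnegrE; lra.
Qed.

Section GraphDistance.
Variables (T : finType) (e : rel T).

Lemma gdist_refl (x : T) : gdist e x x = 0%N.
Proof.
have T_gt0 : (0 < #|T|)%N by apply/card_gt0P; exists x.
have path0 : has_path e (Ordinal T_gt0) x x.
  by apply/existsP; exists [tuple]; rewrite /= eqxx.
apply/eqP; rewrite -leqn0.
exact: (bigmin_le_cond #|T| (fun k : 'I_#|T| => k : nat) path0).
Qed.

Lemma gdist_gt0 (x y : T) : x != y -> (0 < gdist e x y)%N.
Proof.
move=> neq_xy; rewrite /gdist; elim/big_ind: _ => [|a b a0 b0|k].
- by apply/card_gt0P; exists x.
- by rewrite leq_min a0.
case: k => -[|k] //= _ /existsP [p].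
by rewrite tuple0 /= (negPf neq_xy).
Qed.

Lemma gdist_le_diameter (x y : T) : (gdist e x y <= diameter e)%N.
Proof.
by apply: (leq_trans (leq_bigmax y)); apply: (leq_bigmax x).
Qed.

End GraphDistance.

(** Comparing each row of [D] with the row that is constantly 1, resp. 2, off
    the diagonal gives [S <= (l + 1) v_i <= 2 S], where the last bound weakens
    [(l + 2) v_i <= 2 S]; so [a = S / (l + 1)] works. *)
Lemma top_eigenvector_pinched (R : realType) (n : nat) (e : rel 'I_n)
    (v : 'cV[R]_n) :
  (diameter e <= 2)%N -> top_eigenvector (distance_matrix R e) v ->
  exists2 a : R, 0 < a & forall i, a <= v i 0 <= 2 * a.
Proof.
move=> diam_le2 [l [_ Dv v_neq0 v_ge0]].
set S := \sum_i v i 0.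
have [k vk_gt0] : exists k, 0 < v k 0.
  apply/existsP; apply: contraNT v_neq0 => /existsPn v_le0.
  apply/eqP/matrixP => i j; rewrite ord1 mxE; apply/eqP.
  by rewrite eq_le v_ge0 leNgt v_le0.
have S_gt0 : 0 < S.
  by rewrite /S (bigD1 k) //= ltr_wpDr // sumr_ge0.
have row i : l * v i 0 = \sum_(j | j != i) (gdist e i j)%:R * v j 0.
  have := congr1 (fun w : 'cV_n => w i 0) Dv; rewrite !mxE => <-.
  rewrite (bigD1 i) //= mxE gdist_refl mul0r add0r.
  by apply: eq_bigr => j _; rewrite mxE.
have S_split i : S = v i 0 + \sum_(j | j != i) v j 0 by rewrite /S (bigD1 i).
have l_ge0 : 0 <= l.
  rewrite -(pmulr_lge0 _ vk_gt0) row sumr_ge0 // => j _.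
  by rewrite mulr_ge0 ?ler0n.
have l1_gt0 : 0 < l + 1 by rewrite ltr_wpDl.
exists (S / (l + 1)); first exact: divr_gt0.
move=> i; rewrite mulrA ler_pdivrMr // ler_pdivlMr //.
have lower : \sum_(j | j != i) v j 0 <= l * v i 0.
  rewrite row; apply: ler_sum => j neq_ji; rewrite ler_peMl //.
  by rewrite ler1n gdist_gt0 // eq_sym.
have upper : l * v i 0 <= 2 * \sum_(j | j != i) v j 0.
  rewrite row mulr_sumr; apply: ler_sum => j _; apply: ler_wpM2r => //.
  by rewrite ler_nat (leq_trans (gdist_le_diameter _ _ _ _)).
have := S_split i; have := v_ge0 i; lra.
Qed.

Theorem theorem11 (R : realType) (n : nat) (e : rel 'I_n)
  (e_simple : simple_graph e) (e_conn : connected_graph e)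
  (e_diam : diameter e = 2%N)
  (v : 'cV[R]_n) (v_top : top_eigenvector (distance_matrix R e) v)
  (v_norm : norm2 v = 1) :
  inner v (ones R n) / Num.sqrt n%:R >= 4 / 3 * (1 / Num.sqrt 2).
Proof.
have [|a a_gt0 v_pinched] := top_eigenvector_pinched _ _ _ _ _ v_top.
  by rewrite e_diam.
have n_gt0 : (0 < n)%N.
  by case: n e v a_gt0 {e_simple e_conn v_top v_norm v_pinched} e_diam => // e;
    rewrite /diameter big_ord0.
have -> : inner v (ones R n) = \sum_i v i 0.
  by apply: eq_bigr => i _; rewrite mxE mulr1.
have sum_sqr : \sum_i v i 0 ^+ 2 = 1.
  have -> : \sum_i v i 0 ^+ 2 = inner v v.
    by apply: eq_bigr => i _; rewrite expr2.
  have inner_ge0 : 0 <= inner v v.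
    by apply: sumr_ge0 => i _; rewrite -expr2 sqr_ge0.
  by rewrite -[LHS]sqr_sqrtr // -/(norm2 v) v_norm expr1n.
have := reverse_Cauchy_Schwarz_ones _ _ _ _ _ (ltW a_gt0) v_pinched.
rewrite card_ord sum_sqr mulr1; set S := \sum_i v i 0 => S_large.
have S_ge0 : 0 <= S.
  by apply: sumr_ge0 => i _; have /andP[+ _] := v_pinched i; apply: le_trans; lra.
(* With [m = a] and [M = 2 a], both sides of [S_large] are multiples of
   [a ^+ 2]. *)
have {S_large} S_sqr : 8 * n%:R <= 9 * S ^+ 2.
  rewrite -(ler_pM2l (exprn_gt0 2 a_gt0)).
  by apply: le_trans (le_trans S_large _); rewrite le_eqVlt;
    apply/orP; left; apply/eqP; ring.
have n_pos : 0 < n%:R :> R by rewrite ltr0n.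
rewrite -ler_sqr ?nnegrE ?mulr_ge0 ?divr_ge0 ?invr_ge0 ?sqrtr_ge0 ?ler0n //.
rewrite !(exprMn, exprVn) !sqr_sqrtr ?ler0n // ler_pdivlMr //.
lra.
Qed.
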